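(* Let $M$ be a positive integer, $\Omega^{(\mathrm I)}=\{(k_1,k_2)\in(\mathbf Z_{\ge0})^2:\ 2k_1+k_2\le M-2\}$ and $\Omega^{(\mathrm{III})}=\{(k_1,k_2)\in\mathbf Z_{\ge 0}\times\mathbf Z_{\ge1}:\ 2k_1+k_2\le M-2\}$. Write $\ddot H(\heartsuit)=\overset{N=4}{\ddot H}(\Lambda^{(M)(1,0)(\heartsuit)}_{k_1,k_2})$ with $(k_1,k_2)\in\Omega^{(\heartsuit)}$. Then: 1) for $\heartsuit=\mathrm I$ or $\mathrm{III}$: $\mathrm{ch}^{(\pm)}_{\ddot H(\heartsuit)}(\tau+1,z)=-i\,e^{\frac{2\pi i}M(k_1+\frac12)(k_1+k_2+\frac12)}\,\mathrm{ch}^{(\mp)}_{\ddot H(\heartsuit)}(\tau,z)$; 2) (i) $\mathrm{ch}^{(\pm)\mathrm{tw}}_{\ddot H(\mathrm I)}(\tau+1,z)=e^{\frac{2\pi i}M(k_1+1)(k_1+k_2)}\,\mathrm{ch}^{(\pm)\mathrm{tw}}_{\ddot H(\mathrm I)}(\tau,z)$; (ii) $\mathrm{ch}^{(\pm)\mathrm{tw}}_{\ddot H(\mathrm{III})}(\tau+1,z)=e^{\frac{2\pi i}Mk_1(k_1+k_2+1)}\,\mathrm{ch}^{(\pm)\mathrm{tw}}_{\ddot H(\mathrm{III})}(\tau,z)$.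
   Context: $q=e^{2\pi i\tau}$; $\vartheta_{ab}(\tau,z)=\sum_{n\in\mathbf Z}e^{\pi i(n+\frac a2)^2\tau+2\pi i(n+\frac a2)(z+\frac b2)}$ (Mumford), $\eta(\tau)=e^{\pi i\tau/12}\prod_{n\ge1}(1-q^n)$. Affine superalgebra. $\widehat A(1,1)$ is the affine Lie superalgebra of $sl(2|2)/\mathbf CI$ with simple roots $\alpha_0,\alpha_2$ (even), $\alpha_1,\alpha_3$ (odd), and $(\alpha_0|\alpha_0)=2$, $(\alpha_2|\alpha_2)=-2$, $(\alpha_1|\alpha_1)=(\alpha_3|\alpha_3)=(\alpha_1|\alpha_3)=(\alpha_0|\alpha_2)=0$, $(\alpha_0|\alpha_1)=(\alpha_0|\alpha_3)=-1$, $(\alpha_1|\alpha_2)=(\alpha_2|\alpha_3)=1$ (so $\alpha_1,\alpha_3$ coincide as functions on the Cartan subalgebra). $\delta=\sum_{i=0}^3\alpha_i$, $\theta=\alpha_1+\alpha_2+\alpha_3$, $(\Lambda_0|\alpha_j)=\delta_{j,0}$, $(\Lambda_0|\Lambda_0)=0$, $\rho=-\frac12(\alpha_1+\alpha_3)$, dual Coxeter number $0$. The Cartan subalgebra is identified with its dual via $(\cdot|\cdot)$, with coordinates $(\tau,z_1,z_2,t)=2\pi i(-\tau\Lambda_0+z+t\delta)$, $z=-\frac{z_1-z_2}2(\alpha_1+\alpha_3)-z_1\alpha_2$; thus $e^{-\alpha_1}=e^{-\alpha_3}=e^{2\pi iz_1}$, $e^{-\alpha_2}=e^{-2\pi i(z_1+z_2)}$,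 $e^{\Lambda_0}=e^{2\pi it}$, $e^{-\delta}=q$. Put $t_\alpha(\lambda)=\lambda+(\lambda|\delta)\alpha-\{\frac{(\alpha|\alpha)}2(\lambda|\delta)+(\lambda|\alpha)\}\delta$, $r_\theta(\lambda)=\lambda-(\lambda|\theta)\theta$, $r_{\alpha_2}(\lambda)=\lambda+(\lambda|\alpha_2)\alpha_2$, and $w.\lambda=w(\lambda+\rho)-\rho$. Characters of modules. All characters are normalized (super)characters ($+$: character, $-$: supercharacter), $\widehat R^{(\pm)}$ is the (super)denominator, and ''numerator'' means the product $\widehat R^{(\pm)}\mathrm{ch}^{(\pm)}$. They are given by the following formulas. For $0\le m_2\le m$ let $\Lambda^{(m,m_2)}=m\Lambda_0+\frac{m_2}2(\alpha_1+\alpha_3)$ and $F^{(\pm)}=\sum_{j\in\mathbf Z}t_{j\theta}\Big(\frac{e^{\Lambda^{(m,m_2)}+\rho}}{(1\pm e^{-\alpha_1})(1\pm e^{-\alpha_3})}\Big)$; then $\widehat R^{(\pm)}\mathrm{ch}^{(\pm)}_{L(\Lambda^{(m,m_2)})}=F^{(\pm)}-r_\theta F^{(\pm)}$. For $\beta=\beta[b_1,b_2]:=-\frac{b_1-b_2}2(\alpha_1+\alpha_3)-b_1\alpha_2$ and a type $\heartsuit$ put: (I) $\overline y=1$, $\beta=\beta[k_1,-(k_1+k_2)]$; (III) $\overline y=r_{\alpha_2}$, $\beta=\beta[k_1+k_2,-k_1]$. The principal admissible weight is $\Lambda^{(M)(m,m_2)(\heartsuit)}_{k_1,k_2}=(t_\beta\overline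 y).(\Lambda^{(m,m_2)}-(M-1)\frac mM\Lambda_0)$ and its irreducible highest weight module has $[\widehat R^{(\pm)}\mathrm{ch}^{(\pm)}_{L(\Lambda^{(M)(m,m_2)(\heartsuit)}_{k_1,k_2})}](\tau,z,t)=[\widehat R^{(\pm)}\mathrm{ch}^{(\pm)}_{L(\Lambda^{(m,m_2)})}]\big(M\tau,\overline y^{-1}(z+\tau\beta),\frac1M(t+(z|\beta)+\frac{\tau|\beta|^2}2)\big)$. Twisted functions are $f^{\mathrm{tw}}(h)=f(w_0h)$ with $w_0=r_{\alpha_2}t_{-\frac12\alpha_2}$, i.e. $w_0(\tau,z_1,z_2,t)=(\tau,-z_2+\frac\tau2,-z_1+\frac\tau2,t+\frac{z_1+z_2}2-\frac\tau4)$. For $0\le m_2\le m-1$, $\ddot L(\Lambda^{(M)(m,m_2)(\heartsuit)}_{k_1,k_2})=L(\Lambda^{(M)(m,m_2)(\heartsuit)}_{k_1,k_2})\oplus L(\Lambda^{(M)(m,m_2+1)(\heartsuit)}_{k_1,k_2})$, with $\mathrm{ch}^{(\pm)}_{\ddot L}=\mathrm{ch}^{(\pm)}_{L(\Lambda^{(M)(m,m_2)(\heartsuit)}_{k_1,k_2})}\pm\mathrm{ch}^{(\pm)}_{L(\Lambda^{(M)(m,m_2+1)(\heartsuit)}_{k_1,k_2})}$ and the same for twisted characters. N=4 characters. $\overset{N=4}{\ddot H}(\Lambda)$ is the quantum Hamiltonian reduction of $\ddot L(\Lambda)$ for $(x=\frac12\theta,f=e_{-\theta})$, a module of the N=4 superconformal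 algebra of central charge $-6(\frac mM+1)$. Its characters are given by $[\overset{N=4}R{}^{(\pm)}\mathrm{ch}^{(\pm)}_{\ddot H}](\tau,z)=[\widehat R^{(\pm)}\mathrm{ch}^{(\pm)}_{\ddot L}](\tau,z+\frac\tau2,z-\frac\tau2,\frac\tau4)$, and likewise with ''tw'' throughout, where the N=4 denominators are $\overset{N=4}R{}^{(+)}=-i\frac{\eta(\tau)^3\vartheta_{11}(\tau,2z)}{\vartheta_{00}(\tau,z)^2}$, $\overset{N=4}R{}^{(-)}=i\frac{\eta(\tau)^3\vartheta_{11}(\tau,2z)}{\vartheta_{01}(\tau,z)^2}$, $\overset{N=4}R{}^{(+)\mathrm{tw}}=-i\frac{\eta(\tau)^3\vartheta_{11}(\tau,2z)}{\vartheta_{10}(\tau,z)^2}$, $\overset{N=4}R{}^{(-)\mathrm{tw}}=i\frac{\eta(\tau)^3\vartheta_{11}(\tau,2z)}{\vartheta_{11}(\tau,z)^2}$. *)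

(* Defs.v *)
From mathcomp Require Import all_boot all_order all_algebra complex.
From mathcomp Require Import all_classical all_reals all_analysis.

Set Implicit Arguments.
Unset Strict Implicit.
Unset Printing Implicit Defensive.

Import Order.TTheory GRing.Theory Num.Theory.
Import numFieldNormedType.Exports.

Local Open Scope ring_scope.
Local Open Scope classical_set_scope.

Section Complex.
Variable R : realType.

Definition cexp (x : R[i]) : R[i] :=
  Complex (expR (complex.Re x) * cos (complex.Im x))
          (expR (complex.Re x) * sin (complex.Im x)).

Definition imag : R[i] := Complex 0 1.
Definition piC : R[i] := Complex pi 0.
Definition twopii : R[i] := 2 * piC * imag.

Definition limseq (u : nat -> R[i]) : R[i] :=
  limn (u : nat -> (R[i] : numFieldType)).

(* The limit at z over the punctured neighbourhoods of z: the value at z of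
   the meromorphic function that f represents away from a discrete set. *)
Definition mero_val (f : R[i] -> R[i]) (z : R[i]) : R[i] :=
  lim ((f : (R[i] : numFieldType) -> (R[i] : numFieldType)) w
         @[w --> (z : (R[i] : numFieldType))^']).

Definition zsum (f : int -> R[i]) : R[i] :=
  limseq (fun N => \sum_(0 <= n < N) f (Posz n))
  + limseq (fun N => \sum_(0 <= n < N) f (Negz n)).

Definition jtheta (a b : nat) (tau z : R[i]) : R[i] :=
  zsum (fun n => let x := n%:~R + a%:R / 2 in
    cexp (piC * imag * x ^+ 2 * tau + twopii * x * (z + b%:R / 2))).

Definition dedekind_eta (tau : R[i]) : R[i] :=
  cexp (piC * imag * tau / 12)
  * limseq (fun N => \prod_(1 <= n < N.+1) (1 - cexp (twopii * tau) ^+ n)).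

End Complex.

Arguments imag {R}.
Arguments piC {R}.
Arguments twopii {R}.

Variant chsign := Plus | Minus.
Definition oppsign (s : chsign) := if s is Plus then Minus else Plus.

Variant admtype := TypeI | TypeIII.

Section AffineA11.
Variable R : realType.

(* The Cartan subalgebra, identified with its dual by the form.  The basis is
   Lambda_0, alpha_0, alpha_1, alpha_2; alpha_3 = alpha_1 as a function. *)
Definition cartan := 'rV[R[i]]_4.

Definition bvec (i : nat) : cartan := \row_(j < 4) (j == i :> nat)%:R.
Definition Lambda0 : cartan := bvec 0.
Definition alpha0 : cartan := bvec 1.
Definition alpha1 : cartan := bvec 2.
Definition alpha2 : cartan := bvec 3.
Definition alpha3 : cartan := alpha1.

Definition gram : 'M[R[i]]_4 := \matrix_(i < 4, j < 4)
  (nth [::] [:: [:: 0;  1;  0;  0];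
                [:: 1;  2; -1;  0];
                [:: 0; -1;  0;  1];
                [:: 0;  0;  1; -2]] i)`_j.

Definition hform (x y : cartan) : R[i] := (x *m gram *m y^T) 0 0.

Definition delta : cartan := alpha0 + alpha1 + alpha2 + alpha3.
Definition theta_root : cartan := alpha1 + alpha2 + alpha3.
Definition rho : cartan := - (2^-1 *: (alpha1 + alpha3)).

Definition transl (a l : cartan) : cartan :=
  l + hform l delta *: a
  - (hform a a / 2 * hform l delta + hform l a) *: delta.
Definition r_theta (l : cartan) : cartan := l - hform l theta_root *: theta_root.
Definition r_alpha2 (l : cartan) : cartan := l + hform l alpha2 *: alpha2.
Definition dot (w : cartan -> cartan) (l : cartan) : cartan := w (l + rho) - rho.

(* zfin z1 z2 is both the element z of the finite part and beta[z1, z2]. *)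
Definition zfin (z1 z2 : R[i]) : cartan :=
  - ((z1 - z2) / 2 *: (alpha1 + alpha3)) - z1 *: alpha2.
Definition hpoint (tau : R[i]) (z : cartan) (t : R[i]) : cartan :=
  twopii *: (- (tau *: Lambda0) + z + t *: delta).

(* The coordinates of h = hpoint tau z t. *)
Definition tau_of (h : cartan) : R[i] := - (hform h delta / twopii).
Definition t_of (h : cartan) : R[i] := hform h Lambda0 / twopii.
Definition z_of (h : cartan) : cartan :=
  twopii^-1 *: h + tau_of h *: Lambda0 - t_of h *: delta.

Definition expw (l h : cartan) : R[i] := cexp (hform l h).

Definition sgnC (s : chsign) : R[i] := if s is Plus then 1 else -1.

Definition Lambda (m m2 : nat) : cartan :=
  m%:R *: Lambda0 + (m2%:R / 2) *: (alpha1 + alpha3).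

(* w acts on functions by w(e^l) = e^(w l), that is w(f)(h) = f (w^-1 h);
   the inverse of transl (j theta) is transl (- j theta), and r_theta is an
   involution. *)
Definition Fterm (s : chsign) (m m2 : nat) (h : cartan) : R[i] :=
  expw (Lambda m m2 + rho) h
  / ((1 + sgnC s * expw (- alpha1) h) * (1 + sgnC s * expw (- alpha3) h)).
Definition Fsum (s : chsign) (m m2 : nat) (h : cartan) : R[i] :=
  zsum (fun j : int => Fterm s m m2 (transl (- (j%:~R *: theta_root)) h)).

(* (super)denominator times (super)character of L(Lambda m m2) *)
Definition numer (s : chsign) (m m2 : nat) (h : cartan) : R[i] :=
  Fsum s m m2 h - Fsum s m m2 (r_theta h).

Definition ybar (ty : admtype) : cartan -> cartan :=
  if ty is TypeI then id else r_alpha2.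
Definition beta (ty : admtype) (k1 k2 : nat) : cartan :=
  if ty is TypeI then zfin k1%:R (- (k1 + k2)%:R)
  else zfin (k1 + k2)%:R (- k1%:R).

Definition adm_weight (M m m2 : nat) (ty : admtype) (k1 k2 : nat) : cartan :=
  dot (transl (beta ty k1 k2) \o ybar ty)
    (Lambda m m2 - ((M%:R - 1) * (m%:R / M%:R)) *: Lambda0).

(* The same product for L(adm_weight M m m2 ty k1 k2).  The character is
   indexed by the data of the weight; ybar ty is its own inverse. *)
Definition adm_numer (s : chsign) (M m m2 : nat) (ty : admtype) (k1 k2 : nat)
    (h : cartan) : R[i] :=
  let b := beta ty k1 k2 in
  let tau := tau_of h in let z := z_of h in let t := t_of h in
  numer s m m2
    (hpoint (M%:R * tau) (ybar ty (z + tau *: b))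
           ((t + hform z b + tau * hform b b / 2) / M%:R)).

(* The sum of the modules for m2 and m2 + 1. *)
Definition ddot_numer (s : chsign) (M m m2 : nat) (ty : admtype) (k1 k2 : nat)
    (h : cartan) : R[i] :=
  adm_numer s M m m2 ty k1 k2 h + sgnC s * adm_numer s M m m2.+1 ty k1 k2 h.

Definition w0 (h : cartan) : cartan := r_alpha2 (transl (- (2^-1 *: alpha2)) h).
Definition twisted (tw : bool) (f : cartan -> R[i]) (h : cartan) : R[i] :=
  if tw then f (w0 h) else f h.

(* The boolean tw selects the twisted object. *)
Definition N4_denom (s : chsign) (tw : bool) (tau z : R[i]) : R[i] :=
  (if s is Plus then - imag else imag)
  * (dedekind_eta tau ^+ 3 * jtheta 1 1 tau (2 * z))
  / (jtheta tw (if s is Plus then 0%N else 1%N) tau z) ^+ 2.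

Definition N4_numer (s : chsign) (tw : bool) (M m m2 : nat) (ty : admtype)
    (k1 k2 : nat) (tau z : R[i]) : R[i] :=
  twisted tw (ddot_numer s M m m2 ty k1 k2)
    (hpoint tau (zfin (z + tau / 2) (z - tau / 2)) (tau / 4)).

(* The N=4 (super)character of the reduction of the module with numerator
   ddot_numer: the meromorphic function of z whose product with the
   denominator is N4_numer (zeros of the denominator can be removable). *)
Definition N4_ch (s : chsign) (tw : bool) (M m m2 : nat) (ty : admtype)
    (k1 k2 : nat) (tau z : R[i]) : R[i] :=
  mero_val
    (fun w => N4_numer s tw M m m2 ty k1 k2 tau w / N4_denom s tw tau w) z.

End AffineA11.

(* Over int, since M - 2 is negative for M = 1. *)
Definition Omega (M : nat) (ty : admtype) (k1 k2 : nat) : bool :=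
  (if ty is TypeIII then (1 <= k2)%N else true)
  && ((2 * k1 + k2)%N%:Z <= M%:Z - 2).

(* Main.v *)
Require Import Defs.
From mathcomp Require Import all_boot all_order all_algebra complex ring.
From mathcomp Require Import all_classical all_reals all_analysis.

Set Implicit Arguments.
Unset Strict Implicit.
Unset Printing Implicit Defensive.

Import Order.TTheory GRing.Theory Num.Theory.
Import numFieldNormedType.Exports.

Local Open Scope ring_scope.

(** The theorem describes how the N=4 characters of level m = 1 transform under
    T : tau -> tau + 1.  It is true because T acts on every series and product
    that enters a character term by term, through a constant that does not
    depend on the index of summation.

    Numerators.  Let q = e^(2 pi i tau) and let (tau, z1, z2, t) be the
    coordinates of a point of the Cartan subalgebra, u = e^(2 pi i z1),
    v = e^(2 pi i z2).  The sum F^(+-) is e^(2 pi i m t) times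

      sum_j (u/v)^(m j) q^(m j^2) (u q^j)^(1 - m2) / (1 +- u q^j)^2.

    In coordinates (see [N4_numer_point]) the numerator of the module with
    parameters (M, k1, k2) at the point w is the numerator of L(Lambda m m2) at

      (M tau, sg w + tau x, sg w - tau y, (kp w + tau x y) / M),

    where sg = 1 or -1, kp is an integer and the pair of labels (x, y) is
    (k1, k1 + k2) plus (1/2, 1/2), (1, 0) or (0, 1) in the untwisted, the
    twisted type I and the twisted type III case.
    Under T these coordinates move by M, x, -y and x y / M.  The shift of the
    last one yields the factor e^(2 pi i x y / M), which is the eigenvalue in
    the theorem.  In the twisted case x and y are integers, so that each term
    is otherwise unchanged.  In the untwisted case they are half-integers, u
    and v change sign, u/v does not, and the sign in the denominators
    1 +- u q^j is reversed: T exchanges characters and supercharacters.  The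
    numerators (u q^j)^(1 - m2) then give (-1)^(1 - m2), which together with
    the sign in front of the m2 = 1 summand amounts to a global sign
    ([N4_numerT]).

    Denominators.  T multiplies eta^3 and theta_11 by e^(pi i / 4) each,
    theta_10^2 and theta_11^2 by i, and exchanges theta_00 and theta_01; this
    comes down to n^2 and n having the same parity ([N4_denomT]).

    Passing to the quotient, and then to the value of the meromorphic function
    that it represents, commutes with the constants ([N4_chT]). *)

(** * Limits, series and scalar factors *)

(** This holds whether or not the limit exists: the limit of a divergent family
    is the base point of the field, which is 0, and a nonzero factor changes
    neither convergence nor divergence.  Identities between the terms of two
    series thus pass to their sums with no estimate. *)
Lemma limM_cst {K : numFieldType} {T : Type} (F : set_system T)
    {FF : ProperFilter F} (c : K) (f : T -> K) :
  lim (c * f x @[x --> F])%classic = c * lim (f x @[x --> F])%classic.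
Proof.
have [->|c0] := eqVneq c 0.
  under eq_fun do rewrite mul0r.
  by rewrite mul0r; apply: lim_cst.
have [cf|ncf] := pselect (cvg (f x @[x --> F])%classic).
  by apply: cvg_lim => //; apply: cvgMl_tmp.
rewrite (dvgP ncf) dvgP ?mulr0 // => ccf; apply: ncf.
by move: ccf; rewrite is_cvgMlE_tmp.
Qed.

Section Scaling.
Variable R : realType.
Implicit Types (c x y z tau : R[i]).

Lemma limseqM_cst c (u : nat -> R[i]) :
  limseq (fun n => c * u n) = c * limseq u.
Proof. exact: limM_cst. Qed.

Lemma mero_valM_cst c (f : R[i] -> R[i]) z :
  mero_val (fun w => c * f w) z = c * mero_val f z.
Proof. exact: limM_cst. Qed.

Lemma zsum_scale c (f g : int -> R[i]) :
  (forall n, f n = c * g n) -> zsum f = c * zsum g.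
Proof.
move=> fg; rewrite /zsum mulrDr -!limseqM_cst.
by congr (limseq _ + limseq _); apply/funext => N; rewrite mulr_sumr;
   apply: eq_bigr => n _; exact: fg.
Qed.

(** * The exponential at rational multiples of 2 pi i *)

Lemma cexpD x y : cexp (x + y) = cexp x * cexp y.
Proof.
case: x y => [a b] [c d]; apply/eqP.
rewrite eq_complex /= expRD cosD sinD; apply/andP; split; apply/eqP; ring.
Qed.

Lemma cexp0 : cexp 0 = 1 :> R[i].
Proof. by rewrite /cexp /= expR0 cos0 sin0 mulr1 mulr0. Qed.

Lemma twopiiE : twopii = Complex 0 (pi *+ 2) :> R[i].
Proof.
apply/eqP; rewrite /twopii /piC /imag eq_complex /=.
by apply/andP; split; apply/eqP; ring.
Qed.

Lemma cexp_twopii : cexp twopii = 1 :> R[i].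
Proof. by rewrite twopiiE /cexp /= expR0 cos2pi sin2pi mulr1 mulr0. Qed.

Lemma twopii_neq0 : twopii != 0 :> R[i].
Proof.
by rewrite twopiiE eq_complex /= negb_and mulrn_eq0 /= (gt_eqF (pi_gt0 R)) orbT.
Qed.

Lemma cexp_quarter : cexp (twopii / 4) = imag :> R[i].
Proof.
have -> : twopii / 4 = Complex 0 (pi / 2) :> R[i].
  have -> : twopii / 4 = imag * piC / 2 :> R[i] by rewrite /twopii; field.
  have -> : Complex 0 (pi / 2) = imag * Complex (pi / 2) 0 :> R[i].
    by apply/eqP; rewrite eq_complex /=; apply/andP; split; apply/eqP; ring.
  have -> : piC = 2 * Complex (pi / 2) 0 :> R[i].
    by apply/eqP; rewrite eq_complex /=; apply/andP; split; apply/eqP; field.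
  by field.
by rewrite /cexp /= expR0 cos_pihalf sin_pihalf mulr1 mulr0.
Qed.

Lemma imag_sq : imag ^+ 2 = -1 :> R[i].
Proof.
by apply/eqP; rewrite /imag eq_complex /=; apply/andP; split; apply/eqP; ring.
Qed.

Lemma cexp_half : cexp (twopii / 2) = -1 :> R[i].
Proof. by rewrite -imag_sq -cexp_quarter expr2 -cexpD; congr cexp; field. Qed.

Lemma cexp_int (n : int) : cexp (twopii * n%:~R) = 1 :> R[i].
Proof.
have pos (k : nat) : cexp (twopii * k%:R) = 1 :> R[i].
  elim: k => [|k IH]; first by rewrite mulr0 cexp0.
  by rewrite -addn1 natrD mulrDr cexpD IH mulr1 cexp_twopii mulr1.
case: n => k; first exact: pos.
rewrite NegzE mulrNz -[LHS]mul1r -{1}(pos k.+1) -cexpD.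
by rewrite pmulrn mulrN subrr cexp0.
Qed.

(** Every comparison of two exponentials below reduces to exhibiting the integer
    by which the exponents, in units of 2 pi i, differ. *)
Lemma cexp_shift (n : int) x y : x - y = n%:~R ->
  cexp (twopii * x) = cexp (twopii * y).
Proof.
by move=> xy; rewrite -[x](subrK y) xy mulrDr cexpD cexp_int mul1r.
Qed.

(** * Theta functions, the eta function and the denominators *)

Lemma sqr_int_parity (n : int) :
  {m : int | (n%:~R : R[i]) ^+ 2 = n%:~R + 2 * m%:~R}.
Proof.
have [k [->|->]] : {k : int & {n = k * 2} + {n = k * 2 + 1}}.
- exists (n %/ 2)%Z.
  move: (divz_eq n 2) (modz_ge0 n (isT : 2%:Z != 0)).
  move: (ltz_mod n (isT : 2%:Z != 0)).
  by case: (n %% 2)%Z => [[|[|r]]|r] //= _ nE _; [left|right];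
    rewrite ?addr0 in nE.
- exists (2 * k ^+ 2 - k); rewrite !(rmorphD, rmorphM, rmorphB, rmorphXn) /=.
  by ring.
- exists (2 * k ^+ 2 + k); rewrite !(rmorphD, rmorphM, rmorphB, rmorphXn) /=.
  by ring.
Qed.

Lemma jtheta_exponentE (b : nat) tau z (x : R[i]) :
  piC * imag * x ^+ 2 * tau + twopii * x * (z + b%:R / 2)
  = twopii * (x ^+ 2 * tau / 2 + x * (z + b%:R / 2)).
Proof. by rewrite /twopii; field. Qed.

(** The exponent gains (n + 1/2)^2 / 2 = (n^2 + n) / 2 + 1/8 and n^2 + n is
    even. *)
Lemma jtheta1T (b : nat) tau z :
  jtheta 1 b (tau + 1) z = cexp (twopii / 8) * jtheta 1 b tau z.
Proof.
apply: zsum_scale => n /=; rewrite !jtheta_exponentE -cexpD -mulrDr.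
have [m mE] := sqr_int_parity n.
apply: (@cexp_shift (m + n)); rewrite rmorphD /=.
have -> : m%:~R = (n%:~R ^+ 2 - n%:~R) / 2 :> R[i] by rewrite mE; field.
by field.
Qed.

(** The exponent gains n^2 / 2, which is n / 2 up to an integer: this is the
    shift of the argument by 1/2 that distinguishes theta_00 and theta_01. *)
Lemma jtheta00T tau z : jtheta 0 0 (tau + 1) z = jtheta 0 1 tau z.
Proof.
rewrite -[RHS]mul1r; apply: zsum_scale => n /=.
rewrite mul1r !jtheta_exponentE; have [m mE] := sqr_int_parity n.
apply: (@cexp_shift m).
have -> : m%:~R = (n%:~R ^+ 2 - n%:~R) / 2 :> R[i] by rewrite mE; field.
by field.
Qed.

Lemma jtheta01T tau z : jtheta 0 1 (tau + 1) z = jtheta 0 0 tau z.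
Proof.
rewrite -[RHS]mul1r; apply: zsum_scale => n /=.
rewrite mul1r !jtheta_exponentE; have [m mE] := sqr_int_parity n.
apply: (@cexp_shift (m + n)); rewrite rmorphD /=.
have -> : m%:~R = (n%:~R ^+ 2 - n%:~R) / 2 :> R[i] by rewrite mE; field.
by field.
Qed.

Lemma dedekind_etaT tau :
  dedekind_eta (tau + 1) = cexp (twopii / 24) * dedekind_eta tau.
Proof.
rewrite /dedekind_eta mulrA -cexpD.
have -> : cexp (twopii * (tau + 1)) = cexp (twopii * tau) :> R[i].
  by apply: (@cexp_shift 1); rewrite addrC addKr.
by congr (cexp _ * _); rewrite /twopii; field.
Qed.

(** The (super)character into which T turns the one of sign s: the two are
    exchanged in the untwisted sector only. *)
Definition flip (tw : bool) (s : chsign) : chsign :=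
  if tw then s else oppsign s.

Lemma N4_denomT s (tw : bool) tau z :
  N4_denom s tw (tau + 1) z
  = (if tw then 1 else - imag) * N4_denom (flip tw s) tw tau z.
Proof.
have e8 : cexp (twopii / 24) ^+ 3 * cexp (twopii / 8) = imag :> R[i].
  by rewrite !exprS expr0 mulr1 -!cexpD -cexp_quarter; congr cexp; field.
have e8' : cexp (twopii / 8) ^+ 2 = imag :> R[i].
  by rewrite expr2 -!cexpD -cexp_quarter; congr cexp; field.
have i0 : imag != 0 :> R[i].
  by rewrite eq_complex /= oner_eq0 andbF.
rewrite /N4_denom jtheta1T dedekind_etaT exprMn.
set E := dedekind_eta _ ^+ 3; set T := jtheta 1 1 _ _.
rewrite [_ * (_ * T)]mulrACA e8; case: tw => /=.
  rewrite jtheta1T exprMn e8' invfM; set D := (_ ^+ 2)^-1.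
  by case: s @D => D; field.
by case: s => /=; rewrite ?jtheta00T ?jtheta01T; set D := (_ ^+ 2)^-1; ring.
Qed.

End Scaling.

(** * The Cartan subalgebra in coordinates *)

Section Cartan.
Variable R : realType.
Implicit Types (a b c d t tau z w x y : R[i]).

(** Coordinates on the basis Lambda_0, alpha_0, alpha_1, alpha_2: with the
    operations expressed on them, every identity between elements of the Cartan
    subalgebra becomes one between rational expressions, entry by entry. *)
Definition vec a b c d : cartan R := \row_(j < 4) [:: a; b; c; d]`_j.

Lemma vecD a b c d a' b' c' d' :
  vec a b c d + vec a' b' c' d' = vec (a + a') (b + b') (c + c') (d + d').
Proof. by apply/rowP => -[[|[|[|[|//]]]] lti]; rewrite !mxE. Qed.

Lemma vecN a b c d : - vec a b c d = vec (- a) (- b) (- c) (- d).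
Proof. by apply/rowP => -[[|[|[|[|//]]]] lti]; rewrite !mxE. Qed.

Lemma vecZ x a b c d : x *: vec a b c d = vec (x * a) (x * b) (x * c) (x * d).
Proof. by apply/rowP => -[[|[|[|[|//]]]] lti]; rewrite !mxE. Qed.

Lemma Lambda0E : Lambda0 R = vec 1 0 0 0.
Proof. by apply/rowP => -[[|[|[|[|//]]]] lti]; rewrite !mxE. Qed.
Lemma alpha0E : alpha0 R = vec 0 1 0 0.
Proof. by apply/rowP => -[[|[|[|[|//]]]] lti]; rewrite !mxE. Qed.
Lemma alpha1E : alpha1 R = vec 0 0 1 0.
Proof. by apply/rowP => -[[|[|[|[|//]]]] lti]; rewrite !mxE. Qed.
Lemma alpha2E : alpha2 R = vec 0 0 0 1.
Proof. by apply/rowP => -[[|[|[|[|//]]]] lti]; rewrite !mxE. Qed.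

Lemma hform_vec a b c d a' b' c' d' :
  hform (vec a b c d) (vec a' b' c' d')
  = a * b' + b * a' + 2 * b * b' - b * c' - c * b' + c * d' + d * c'
    - 2 * d * d'.
Proof.
rewrite /hform !mxE !big_ord_recl big_ord0 !mxE !big_ord_recl !big_ord0 !mxE /=.
ring.
Qed.

Definition vecE := (vecD, vecN, vecZ, hform_vec).

(** The point with coordinates (tau, z1, z2, t). *)
Definition hpt tau z1 z2 t : cartan R := hpoint tau (zfin z1 z2) t.

Lemma hpt_congr tau z1 z2 t z1' z2' t' :
  z1 = z1' -> z2 = z2' -> t = t' -> hpt tau z1 z2 t = hpt tau z1' z2' t'.
Proof. by move=> -> -> ->. Qed.

Lemma zfinE z1 z2 : zfin z1 z2 = vec 0 0 (z2 - z1) (- z1).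
Proof.
by rewrite /zfin /alpha3 alpha1E alpha2E !vecE; congr vec; field.
Qed.

Lemma deltaE : delta R = vec 0 1 2 1.
Proof.
by rewrite /delta /alpha3 alpha0E alpha1E alpha2E !vecE; congr vec; ring.
Qed.

Lemma hpointE tau a b c d t : hpoint tau (vec a b c d) t
  = vec (twopii * (a - tau)) (twopii * (b + t)) (twopii * (c + 2 * t))
        (twopii * (d + t)).
Proof.
by rewrite /hpoint Lambda0E deltaE !vecE; congr vec; ring.
Qed.

Lemma hptE tau z1 z2 t : hpt tau z1 z2 t
  = vec (- twopii * tau) (twopii * t) (twopii * (z2 - z1 + 2 * t))
        (twopii * (t - z1)).
Proof.
by rewrite /hpt zfinE hpointE; congr vec; ring.
Qed.

Lemma transl_hpt b1 b2 tau z1 z2 t :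
  transl (zfin b1 b2) (hpt tau z1 z2 t)
  = hpt tau (z1 - tau * b1) (z2 - tau * b2)
        (t + (z1 * b2 + z2 * b1) - tau * b1 * b2).
Proof.
by rewrite /transl !hptE zfinE deltaE !vecE; congr vec; field.
Qed.

Lemma r_theta_hpt tau z1 z2 t : r_theta (hpt tau z1 z2 t) = hpt tau z2 z1 t.
Proof.
rewrite /r_theta /theta_root /alpha3 !hptE alpha1E alpha2E !vecE.
by congr vec; ring.
Qed.

Lemma r_alpha2_zfin z1 z2 : r_alpha2 (zfin z1 z2) = zfin (- z2) (- z1).
Proof. by rewrite /r_alpha2 !zfinE alpha2E !vecE; congr vec; ring. Qed.

Lemma r_alpha2_hpt tau z1 z2 t :
  r_alpha2 (hpt tau z1 z2 t) = hpt tau (- z2) (- z1) t.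
Proof. by rewrite /r_alpha2 !hptE alpha2E !vecE; congr vec; ring. Qed.

(** The translation part of w0 is that of -alpha_2 / 2, which is
    beta[1/2, 1/2]. *)
Lemma w0_hpt tau z1 z2 t :
  w0 (hpt tau z1 z2 t)
  = hpt tau (tau / 2 - z2) (tau / 2 - z1) (t + (z1 + z2) / 2 - tau / 4).
Proof.
have E : - (2^-1 *: alpha2 R) = zfin (2^-1) (2^-1).
  by rewrite zfinE alpha2E !vecE; congr vec; ring.
by rewrite /w0 E transl_hpt r_alpha2_hpt; apply: hpt_congr; field.
Qed.

Lemma tau_of_hpt tau z1 z2 t : tau_of (hpt tau z1 z2 t) = tau.
Proof.
by rewrite /tau_of hptE deltaE !vecE; field; apply: twopii_neq0.
Qed.

Lemma t_of_hpt tau z1 z2 t : t_of (hpt tau z1 z2 t) = t.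
Proof.
by rewrite /t_of hptE Lambda0E !vecE; field; apply: twopii_neq0.
Qed.

Lemma z_of_hpt tau z1 z2 t : z_of (hpt tau z1 z2 t) = zfin z1 z2.
Proof.
rewrite /z_of tau_of_hpt t_of_hpt hptE Lambda0E deltaE zfinE !vecE.
by congr vec; field; apply: twopii_neq0.
Qed.

Lemma hform_zfin z1 z2 b1 b2 :
  hform (zfin z1 z2) (zfin b1 b2) = - (z1 * b2 + z2 * b1).
Proof. by rewrite !zfinE !vecE; ring. Qed.

Lemma zfinD z1 z2 b1 b2 :
  zfin z1 z2 + zfin b1 b2 = zfin (z1 + b1) (z2 + b2) :> cartan R.
Proof. by rewrite !zfinE !vecE; congr vec; ring. Qed.

Lemma zfinZ x b1 b2 : x *: zfin b1 b2 = zfin (x * b1) (x * b2) :> cartan R.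
Proof. by rewrite !zfinE !vecE; congr vec; ring. Qed.

Lemma expw_alpha1_hpt tau z1 z2 t :
  expw (- alpha1 R) (hpt tau z1 z2 t) = cexp (twopii * z1).
Proof. by rewrite /expw alpha1E hptE !vecE; congr cexp; ring. Qed.

Lemma expw_LambdaD_rho (m m2 : nat) tau z1 z2 t :
  expw (Lambda R m m2 + rho R) (hpt tau z1 z2 t)
  = cexp (twopii * (m%:R * t + (1 - m2%:R) * z1)).
Proof.
rewrite /expw /Lambda /rho /alpha3 alpha1E Lambda0E hptE !vecE.
by congr cexp; field.
Qed.

Lemma Fterm_hpt s (m m2 : nat) tau z1 z2 t :
  Fterm s m m2 (hpt tau z1 z2 t)
  = cexp (twopii * (m%:R * t + (1 - m2%:R) * z1))
    / (1 + sgnC R s * cexp (twopii * z1)) ^+ 2.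
Proof.
by rewrite /Fterm /alpha3 expw_LambdaD_rho expw_alpha1_hpt expr2.
Qed.

(** The j-th term of the sum over the translations by multiples of theta thus
    falls under [transl_hpt]. *)
Lemma theta_rootZ x : - (x *: theta_root R) = zfin x (- x).
Proof.
by rewrite /theta_root /alpha3 alpha1E alpha2E zfinE !vecE; congr vec; ring.
Qed.

End Cartan.

(** * The numerators under tau -> tau + 1 *)

Section Modular.
Variable R : realType.
Implicit Types (c t tau z w : R[i]).

Lemma cexp_nat_half (k : nat) : cexp (twopii * (k%:R / 2)) = (-1) ^+ k :> R[i].
Proof.
elim: k => [|k IH]; first by rewrite mul0r mulr0 cexp0.
rewrite exprS -IH -cexp_half -cexpD; congr cexp.
by rewrite -addn1 natrD; field.
Qed.

(** The class modulo 1 by which z1 and z2 move under T. *)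
Definition shift_part (tw : bool) : R[i] := if tw then 0 else 1 / 2.

(** The value of e^(2 pi i (1 - m2) h) at h = 0 (twisted) or 1/2 (untwisted). *)
Definition shift_sign (tw : bool) (m2 : nat) : R[i] :=
  if tw then 1 else (-1) ^+ m2.+1.

(** The two shifts of z1 and z2 agree modulo 1, so that their difference, which
    is what j multiplies, is an integer.  The common half-integer enters only
    through u = e^(2 pi i z1): as a sign in the denominator, absorbed by [flip],
    and as the sign of u^(1 - m2). *)
Lemma Fterm_shift s tw (m m2 : nat) (n a b j : int) tau z1 z2 t c :
  Fterm s m m2 (transl (- (j%:~R *: theta_root R))
    (hpt (tau + n%:~R) (z1 + shift_part tw + a%:~R)
         (z2 + shift_part tw + b%:~R) (t + c)))
  = shift_sign tw m2 * cexp (twopii * (m%:R * c))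
    * Fterm (flip tw s) m m2
        (transl (- (j%:~R *: theta_root R)) (hpt tau z1 z2 t)).
Proof.
rewrite theta_rootZ !transl_hpt !Fterm_hpt mulrA; congr (_ / (1 + _) ^+ 2).
  have -> : shift_sign tw m2 = cexp (twopii * (m2.+1%:R * shift_part tw)).
    rewrite /shift_sign /shift_part; case: tw; first by rewrite !mulr0 cexp0.
    by rewrite mul1r cexp_nat_half.
  rewrite -!cexpD -!mulrDr.
  (* In order: the shifts of the exponents in (v/u)^(m j) q^(m j^2) and in
     (u q^(- j))^(1 - m2), and, untwisted, (1 - m2) / 2 - (1 + m2) / 2. *)
  pose k : int := m%:Z * (j * (b - a) + n * j ^+ 2) + (1 - m2%:Z) * (a - n * j)
    - (if tw then 0 else m2%:Z).
  apply: (@cexp_shift _ k).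
  rewrite /k !(rmorphD, rmorphM, rmorphB, rmorphXn, rmorphN) /=.
  rewrite -addn1 natrD /shift_part.
  by case: (tw); field.
have -> : sgnC R (flip tw s) = sgnC R s * cexp (twopii * shift_part tw).
  rewrite /shift_part; case: tw; first by rewrite mulr0 cexp0 mulr1.
  by rewrite mulrA mulr1 cexp_half; case: s => /=; ring.
rewrite -mulrA -cexpD -mulrDr; congr (_ * _).
apply: (@cexp_shift _ (a - n * j)).
by rewrite !(rmorphM, rmorphB) /=; ring.
Qed.

Lemma numer_shift s tw (m m2 : nat) (n a b : int) tau z1 z2 t c :
  numer s m m2
    (hpt (tau + n%:~R) (z1 + shift_part tw + a%:~R)
         (z2 + shift_part tw + b%:~R) (t + c))
  = shift_sign tw m2 * cexp (twopii * (m%:R * c))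
    * numer (flip tw s) m m2 (hpt tau z1 z2 t).
Proof.
rewrite /numer !r_theta_hpt /Fsum mulrBr.
by congr (_ - _); apply: zsum_scale => j; apply: Fterm_shift.
Qed.

(** The labels (x, y) of a module: its T-eigenvalue is e^(2 pi i x y / M). *)
Definition label1 (tw : bool) (ty : admtype) (k1 : nat) : R[i] :=
  k1%:R + if tw then if ty is TypeI then 1 else 0 else 1 / 2.
Definition label2 (tw : bool) (ty : admtype) (k1 k2 : nat) : R[i] :=
  k1%:R + k2%:R + if tw then if ty is TypeI then 0 else 1 else 1 / 2.

Lemma adm_numer_hpt s (M m m2 : nat) ty k1 k2 tau z1 z2 t :
  adm_numer s M m m2 ty k1 k2 (hpt tau z1 z2 t)
  = if ty is TypeI then
      numer s m m2 (hpt (M%:R * tau)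
        (z1 + tau * k1%:R) (z2 - tau * (k1%:R + k2%:R))
        ((t + z1 * (k1%:R + k2%:R) - z2 * k1%:R
          + tau * k1%:R * (k1%:R + k2%:R)) / M%:R))
    else
      numer s m m2 (hpt (M%:R * tau)
        (tau * k1%:R - z2) (- z1 - tau * (k1%:R + k2%:R))
        ((t + z1 * k1%:R - z2 * (k1%:R + k2%:R)
          + tau * k1%:R * (k1%:R + k2%:R)) / M%:R)).
Proof.
rewrite /adm_numer tau_of_hpt z_of_hpt t_of_hpt.
case: ty => /=; rewrite zfinZ zfinD ?r_alpha2_zfin !hform_zfin -/(hpt _ _ _ _);
  rewrite natrD; congr (numer _ _ _ _); apply: hpt_congr.
- by [].
- by ring.
- by congr (_ / _); field.
- by ring.
- by ring.
- by congr (_ / _); field.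
Qed.

(** The shape of the point at which the numerator is evaluated: up to the factor
    - 1 / M, the coefficient of tau in the last coordinate is the product of
    those in the two middle ones.  The constants sg and kp depend neither on tau
    nor on w, so that T moves the point by constants. *)
Lemma N4_numer_point tw (M : nat) ty k1 k2 :
  exists sg kp : R[i], forall s (m m2 : nat) tau w,
  twisted tw (adm_numer s M m m2 ty k1 k2)
    (hpoint tau (zfin (w + tau / 2) (w - tau / 2)) (tau / 4))
  = numer s m m2 (hpt (M%:R * tau)
      (sg * w + tau * label1 tw ty k1) (sg * w - tau * label2 tw ty k1 k2)
      ((kp * w + tau * (label1 tw ty k1 * label2 tw ty k1 k2)) / M%:R)).
Proof.
rewrite /twisted /label1 /label2.
exists (if tw then if ty is TypeI then -1 else 1
        else if ty is TypeI then 1 else -1).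
exists (if tw then if ty is TypeI then 1 - k2%:R else 1 + k2%:R
        else if ty is TypeI then k2%:R else - k2%:R).
move=> s m m2 tau w; rewrite -/(hpt _ _ _ _).
case: tw; rewrite ?w0_hpt adm_numer_hpt; case: ty;
  congr (numer _ _ _ _); apply: hpt_congr; try congr (_ / M%:R); by field.
Qed.

(** Untwisted, the terms of m2 = 0 and m2 = 1 acquire the signs -1 and +1, while
    the sign s between them becomes - s; both effects add up to -1. *)
Lemma N4_numerT s tw (M : nat) ty k1 k2 tau w :
  N4_numer s tw M 1 0 ty k1 k2 (tau + 1) w
  = (if tw then 1 else -1)
    * cexp (twopii / M%:R * label1 tw ty k1 * label2 tw ty k1 k2)
    * N4_numer (flip tw s) tw M 1 0 ty k1 k2 tau w.
Proof.
have [sg [kp E]] := N4_numer_point tw M ty k1 k2.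
(* A is the contribution of one value of m2.  It is abstract so that ring takes
   its values at tau and tau + 1 as atoms instead of unfolding them. *)
have [A AE] : exists A : chsign -> nat -> R[i] -> R[i], forall s0 m2 tau0,
    A s0 m2 tau0 = twisted tw (adm_numer s0 M 1 m2 ty k1 k2)
      (hpoint tau0 (zfin (w + tau0 / 2) (w - tau0 / 2)) (tau0 / 4)) by eexists.
have ddotE s0 tau0 : N4_numer s0 tw M 1 0 ty k1 k2 tau0 w
    = A s0 0%N tau0 + sgnC R s0 * A s0 1%N tau0.
  by rewrite !AE /N4_numer /twisted; case: (tw).
have shift s0 m2 : A s0 m2 (tau + 1) = shift_sign tw m2
    * cexp (twopii / M%:R * label1 tw ty k1 * label2 tw ty k1 k2)
    * A (flip tw s0) m2 tau.
  (* The integer parts of x and - y, beyond the common shift_part. *)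
  pose a : int := if tw then if ty is TypeI then k1.+1 else k1 else k1.
  pose b : int := - (k1%:Z + k2%:Z + (if tw then if ty is TypeI then 0 else 1
                   else 1)).
  have label1E : label1 tw ty k1 = shift_part tw + a%:~R.
    rewrite /label1 /shift_part /a.
    by case: (tw); case: (ty); rewrite /= -?[k1.+1]addn1 ?PoszD ?rmorphD /=; ring.
  have label2E : - label2 tw ty k1 k2 = shift_part tw + b%:~R.
    rewrite /label2 /shift_part /b.
    by case: (tw); case: (ty); rewrite rmorphN !rmorphD /=; field.
  rewrite !AE !E; set h := hpt _ _ _ _.
  have -> : h = hpt (M%:R * tau + M%:~R)
      (sg * w + tau * label1 tw ty k1 + shift_part tw + a%:~R)
      (sg * w - tau * label2 tw ty k1 k2 + shift_part tw + b%:~R)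
      ((kp * w + tau * (label1 tw ty k1 * label2 tw ty k1 k2)) / M%:R
       + label1 tw ty k1 * label2 tw ty k1 k2 / M%:R).
    rewrite /h -!addrA -label1E -label2E mulrDr mulr1.
    by apply: hpt_congr; ring.
  rewrite numer_shift mul1r; congr (_ * cexp _ * _); ring.
rewrite !ddotE !shift /shift_sign.
by case: (tw) => /=; case: s => /=; ring.
Qed.

(** * The characters under tau -> tau + 1 *)

(** The untwisted constant is -1 from the numerator over -i from the
    denominator, that is -i. *)
Lemma N4_chT s tw (M : nat) ty k1 k2 tau z :
  N4_ch s tw M 1 0 ty k1 k2 (tau + 1) z
  = (if tw then 1 else - imag)
    * cexp (twopii / M%:R * label1 tw ty k1 * label2 tw ty k1 k2)
    * N4_ch (flip tw s) tw M 1 0 ty k1 k2 tau z.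
Proof.
rewrite /N4_ch -mero_valM_cst; congr (mero_val _ z); apply/funext => w.
rewrite N4_numerT N4_denomT invfM.
have -> : (if tw then 1 else - imag)^-1 = (if tw then 1 else imag) :> R[i].
  case: (tw); first exact: invr1.
  by apply: mulr1_eq; rewrite mulNr -expr2 imag_sq opprK.
by case: (tw); ring.
Qed.

End Modular.

Theorem proposition5p6 (R : realType) (M : nat) (hM : (0 < M)%N) :
  (forall (s : chsign) (ty : admtype) (k1 k2 : nat) (tau z : R[i]),
     Omega M ty k1 k2 -> 0 < complex.Im tau ->
     N4_ch s false M 1 0 ty k1 k2 (tau + 1) z
     = - imag
       * cexp (twopii / M%:R * (k1%:R + 1 / 2) * (k1%:R + k2%:R + 1 / 2))
       * N4_ch (oppsign s) false M 1 0 ty k1 k2 tau z)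
  /\
  ((forall (s : chsign) (k1 k2 : nat) (tau z : R[i]),
     Omega M TypeI k1 k2 -> 0 < complex.Im tau ->
     N4_ch s true M 1 0 TypeI k1 k2 (tau + 1) z
     = cexp (twopii / M%:R * (k1%:R + 1) * (k1%:R + k2%:R))
       * N4_ch s true M 1 0 TypeI k1 k2 tau z)
   /\
   (forall (s : chsign) (k1 k2 : nat) (tau z : R[i]),
     Omega M TypeIII k1 k2 -> 0 < complex.Im tau ->
     N4_ch s true M 1 0 TypeIII k1 k2 (tau + 1) z
     = cexp (twopii / M%:R * k1%:R * (k1%:R + k2%:R + 1))
       * N4_ch s true M 1 0 TypeIII k1 k2 tau z)).
Proof.
split=> [s ty k1 k2 tau z _ _|].
  by rewrite N4_chT.
by split=> s k1 k2 tau z _ _; rewrite N4_chT mul1r /label1 /label2 !addr0.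
Qed.
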